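(* Let $X\subset\mathbf{P}^2$ be a smooth projective plane curve of degree $a\ge 3$ over $\mathbf{F}_q$, let $m$ be a nonnegative integer, let $L$ be a line of $\mathbf{P}^2$ and let $G_m$ be the pullback of $mL$ by the natural inclusion $X\hookrightarrow\mathbf{P}^2$. Let $P_1,\dots,P_n$ be $n$ rational points of $X$ avoiding the support of $G_m$, let $D=P_1+\cdots+P_n$, and let $d$ be the minimum distance of $C_L(D,G_m)^{\bot}$. (1) If $m\le a-2$ and no $m+2$ of the $P_i$'s are collinear, then $d\ge 2m+2$, and this bound improves that of Goppa. (2) If $m\le a-1$, no $m+2$ of the $P_i$'s are collinear and no $2m+2$ of them lie on a conic, then $d\ge 3m$, and this bound improves that of Goppa. (3) If $m\le a$, no $m+2$ of the $P_i$'s are collinear, no $2m+2$ of them lie on a conic and no $3m$ of them lie on a cubic, then $d\ge 3m+1$, and this bound improves that of Goppa.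
   Context: $C_L(D,G_m)$ denotes the image of the map $L(G_m)\to\mathbf{F}_q^n$, $f\mapsto(f(P_1),\dots,f(P_n))$, where $L(G_m)$ is the Riemann–Roch space of $G_m$; $C^{\bot}$ is the orthogonal space of $C\subset\mathbf{F}_q^n$ for the canonical inner product. The minimum distance of a code is the smallest Hamming weight of a nonzero codeword. The bound of Goppa is $d\ge\delta_G$, where $\delta_G=\deg(G_m)-(2g_X-2)=a(m+3-a)$ is the Goppa designed distance of $C_L(D,G_m)^{\bot}$ and $g_X=(a-1)(a-2)/2$ is the genus of $X$.
   Formalization: In (2), for a = 3 the bound 3m equals the Goppa designed distance, so ''improves that of Goppa'' is stated there as ''is at least as good as''; the strict improvement in (2) is asserted for a ≥ 4. *)

(* Defs.v *)
From HB Require Import structures.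
From mathcomp Require Import all_boot all_order all_algebra.
From mathcomp Require Import mpoly ring.

Set Implicit Arguments.
Unset Strict Implicit.
Unset Printing Implicit Defensive.

Import Order.TTheory GRing.Theory Num.Theory.

Local Open Scope ring_scope.

(* Points of P^2 are given by nonzero vectors of homogeneous coordinates, plane
   curves by nonzero ternary forms. *)

Section Plane.
Variable K : fieldType.

Definition ev (p : {mpoly K[3]}) (x : 'rV[K]_3) : K := p.@[x ord0].

Definition is_curve (k : nat) (C : {mpoly K[3]}) : Prop :=
  C != 0 /\ C \is k.-homog.

Definition projective_points (n : nat) (P : 'I_n -> 'rV[K]_3) : Prop :=
  (forall i, P i != 0) /\
  (forall (i j : 'I_n) (c : K), P i = c *: P j -> i = j).

(* Curves of degree k = 1, 2, 3: lines, conics, cubics. Conics and cubics may be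
   reducible or non-reduced. *)
Definition lie_on_curve (k n : nat) (P : 'I_n -> 'rV[K]_3) (S : {set 'I_n}) :
    Prop :=
  exists2 C : {mpoly K[3]}, is_curve k C & forall i, i \in S -> ev C (P i) = 0.

Definition no_lie_on_curve (r k n : nat) (P : 'I_n -> 'rV[K]_3) : Prop :=
  forall S : {set 'I_n}, #|S| = r -> ~ lie_on_curve k P S.

End Plane.

Section Curve.
(* The base field F, an algebraic closure iota : F -> K, and the equation E of
   a plane curve X over F. The closed points of X are the Galois orbits of its
   K-points. *)
Variables (F : fieldType) (K : closedFieldType) (iota : {rmorphism F -> K}).
Variable E : {mpoly F[3]}.

Definition evK (p : {mpoly F[3]}) (x : 'rV[K]_3) : K := ev (map_mpoly iota p) x.

Definition geom_point (x : 'rV[K]_3) : Prop := x != 0 /\ evK E x = 0.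

Definition smooth_curve : Prop :=
  forall x, geom_point x -> exists i : 'I_3, evK E^`M(i) x != 0.

(* The pair (A, B) stands for the restriction to X of the rational function A/B
   of P^2. The function field F(X) is the set of such pairs satisfying
   [is_ratfun], modulo [ratfun_eq]. *)
Definition frac : Type := ({mpoly F[3]} * {mpoly F[3]})%type.

Definition vanishes_on_X (p : {mpoly F[3]}) : Prop :=
  exists Q : {mpoly F[3]}, p = Q * E.

Definition is_ratfun (f : frac) : Prop :=
  (exists d : nat, f.1 \is d.-homog /\ f.2 \is d.-homog) /\ ~ vanishes_on_X f.2.

Definition ratfun_eq (f g : frac) : Prop :=
  vanishes_on_X (f.1 * g.2 - g.1 * f.2).

Definition frac_mul (f g : frac) : frac := (f.1 * g.1, f.2 * g.2).

(* f belongs to the local ring of X at the closed point below x. *)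
Definition regular_at (f : frac) (x : 'rV[K]_3) : Prop :=
  exists g : frac, [/\ is_ratfun g, ratfun_eq f g & evK g.2 x != 0].

(* f is regular at the F-rational point P of X and f(P) = v. *)
Definition has_value (f : frac) (P : 'rV[F]_3) (v : F) : Prop :=
  exists g : frac,
    [/\ is_ratfun g, ratfun_eq f g, ev g.2 P != 0 & v = ev g.1 P / ev g.2 P].

(* Let l be the equation of a line L. Around a point where the linear form h does
   not vanish, (l/h)^m is a local equation of the pullback G_m of mL to X. *)
Definition local_equation (l : {mpoly F[3]}) (m : nat) (h : {mpoly F[3]}) :
    frac :=
  (l ^+ m, h ^+ m).

(* L(G_m): the rational functions f such that div(f) + G_m >= 0, that is, f times
   a local equation of G_m is regular at every closed point of X. *)
Definition riemann_roch (l : {mpoly F[3]}) (m : nat) (f : frac) : Prop :=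
  is_ratfun f /\
  forall (x : 'rV[K]_3) (h : {mpoly F[3]}),
    geom_point x -> h \is 1.-homog -> evK h x != 0 ->
    regular_at (frac_mul f (local_equation l m h)) x.

(* P is not in the support of G_m. The exponent matters: G_0 = 0 has empty
   support. *)
Definition avoids_support (l : {mpoly F[3]}) (m : nat) (P : 'rV[F]_3) : Prop :=
  ev (l ^+ m) P != 0.

(* C_L(D, G_m), with D = P_1 + ... + P_n. *)
Definition code_L (l : {mpoly F[3]}) (m n : nat) (P : 'I_n -> 'rV[F]_3)
    (c : 'rV[F]_n) : Prop :=
  exists2 f : frac, riemann_roch l m f & forall i, has_value f (P i) (c ord0 i).

End Curve.

Section Codes.
Variables (F : fieldType) (n : nat).

Definition dual_code (C : 'rV[F]_n -> Prop) (y : 'rV[F]_n) : Prop :=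
  forall c, C c -> \sum_i c ord0 i * y ord0 i = 0.

Definition hamming_weight (c : 'rV[F]_n) : nat := #|[set i | c ord0 i != 0]|.

(* The zero code has no minimum distance. *)
Definition is_min_distance (C : 'rV[F]_n -> Prop) (d : nat) : Prop :=
  (exists c, [/\ C c, c != 0 & hamming_weight c = d]) /\
  (forall c, C c -> c != 0 -> (d <= hamming_weight c)%N).

End Codes.

(* For a smooth plane curve of degree a. *)
Definition plane_genus (a : nat) : nat := ((a - 1) * (a - 2) %/ 2)%N.

(* deg(G_m) - (2 g_X - 2), where deg(G_m) = a m. *)
Definition goppa_distance (a m : nat) : int :=
  (a * m)%:Z - (2%:Z * (plane_genus a)%:Z - 2%:Z).

Lemma goppa_distanceE (a m : nat) : (0 < a)%N ->
  goppa_distance a m = a%:Z * (m%:Z + 3%:Z - a%:Z).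
Proof.
case: a => [//|[|b]] _.
  by rewrite /goppa_distance (_ : plane_genus 1 = 0%N) // mul1n; ring.
have e2 : (plane_genus b.+2 * 2 = b.+1 * b)%N.
  rewrite /plane_genus !subSS !subn0 divnK // dvdn2 oddM /=.
  by case: (odd b).
rewrite /goppa_distance [2%:Z * _]mulrC -[_ * 2%:Z]PoszM e2 !PoszM.
rewrite -[b.+2]addn2 -[b.+1]addn1 !PoszD.
by ring.
Qed.

(* Main.v *)
(* The proof only uses that the P_i are distinct points of the plane. A word of
   weight w of the dual code is a linear relation, supported on a set S of w
   points, between the evaluations of the forms of degree m. Multiplying its
   coefficients by the values of a form of degree k gives a relation for the
   degree m - k, supported on the points of S off the corresponding curve. By
   induction on m, residuals with respect to lines and conics show that S lies on
   a line if w <= 2m + 1, on a conic if w < 3m and on a cubic if w <= 3m, unless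
   lines contain at most 2 (resp. 3) points of S and conics at most 5 (resp. 6).
   In this general case the Hilbert function h of S satisfies h(k) >= 3k - 1 by
   induction, hence h(k) >= 3k since by Macaulay its first difference cannot
   increase once it is at most 2. This contradicts h(i) + h(m - i) <= w, the
   orthogonality of the evaluations of the forms of degrees i and m - i with
   respect to the relation, for i = 2 (resp. 3). *)

Require Import Defs.
From HB Require Import structures.
From mathcomp Require Import all_boot all_order all_algebra.
From mathcomp Require Import mpoly.
From mathcomp Require Import ring zify.

Set Implicit Arguments.
Unset Strict Implicit.
Unset Printing Implicit Defensive.

Import Order.TTheory GRing.Theory Num.Theory.

Local Open Scope ring_scope.

(** * Ternary forms and their values *)

Section Forms.
Variable K : fieldType.
Implicit Types (f g : {mpoly K[3]}) (k : nat) (x : 'rV[K]_3).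

Lemma evX i x : ev 'X_i x = x ord0 i.
Proof. exact: mevalXU. Qed.

Lemma evD f g x : ev (f + g) x = ev f x + ev g x. Proof. exact: mevalD. Qed.
Lemma evB f g x : ev (f - g) x = ev f x - ev g x. Proof. exact: mevalB. Qed.
Lemma evM f g x : ev (f * g) x = ev f x * ev g x. Proof. exact: mevalM. Qed.
Lemma evZ c f x : ev (c *: f) x = c * ev f x. Proof. exact: mevalZ. Qed.

Lemma evXn f k x : ev (f ^+ k) x = ev f x ^+ k.
Proof. exact: rmorphXn. Qed.

Lemma ev_sum (I : Type) (r : seq I) (p : pred I) (f : I -> {mpoly K[3]}) x :
  ev (\sum_(i <- r | p i) f i) x = \sum_(i <- r | p i) ev (f i) x.
Proof. exact: raddf_sum. Qed.

Lemma dhomog_homothety k f c x : f \is k.-homog -> ev f (c *: x) = c ^+ k * ev f x.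
Proof.
move=> /dhomogP fk; rewrite [f]mpolyE !ev_sum mulr_sumr.
apply: eq_big_seq => m /fk /= dm; rewrite !evZ mulrCA; congr (_ * _).
rewrite /ev !mevalX -dm mdegE.
transitivity (\prod_(i < 3) (c ^+ m i * x ord0 i ^+ m i)).
  by apply: eq_bigr => i _; rewrite mxE exprMn.
by rewrite big_split /= prodrXr.
Qed.

Lemma dhomog1M k f g : f \is 1.-homog -> g \is k.-homog -> f * g \is k.+1.-homog.
Proof. exact: (@dhomogM _ _ _ 1%N). Qed.

(** Each monomial of positive degree is divisible by a variable. *)
Lemma dhomog_mulX k f : f \is k.+1.-homog ->
  exists2 g : 'I_3 -> {mpoly K[3]},
    forall i, g i \is k.-homog & f = \sum_i 'X_i * g i.
Proof.
move=> /dhomogP fk; rewrite [f]mpolyE big_seq.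
apply: (big_ind (fun f => exists2 g : 'I_3 -> {mpoly K[3]},
    forall i, g i \is k.-homog & f = \sum_i 'X_i * g i)).
- exists (fun=> 0) => [i|]; first exact: dhomog0.
  by rewrite big1 // => i _; rewrite mulr0.
- move=> f1 f2 [g1 h1 ->] [g2 h2 ->]; exists (fun i => g1 i + g2 i) => [i|].
    exact: dhomogD.
  by rewrite -big_split; apply: eq_bigr => i _; rewrite mulrDr.
move=> m /fk /= dm.
have [i mi] : exists i, m i != 0%N.
  apply/existsP; apply/contraT => /existsPn m0; move: dm; rewrite mdegE big1 // => i _.
  by apply/eqP; have := m0 i; rewrite negbK.
have le_im : (U_(i) <= m)%MM by rewrite lep1mP.
exists (fun j => if j == i then f@_m *: 'X_[m - U_(i)] else 0) => [j|].
  case: eqP => _; last exact: dhomog0.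
  apply: dhomogZ; rewrite dhomogX.
  by have := mdegD (m - U_(i)) U_(i); rewrite submK // mdeg1 addn1 dm => -[->].
rewrite (bigD1 i) //= eqxx big1 ?addr0; last by move=> j /negbTE ->; rewrite mulr0.
by rewrite -scalerAr -mpolyXD addmC submK.
Qed.

End Forms.

(** * Nonvanishing of polynomials over an algebraically closed field *)

Section NonVanishing.
Variable K : closedFieldType.

Lemma base_digits_inj (b x0 x1 x2 y0 y1 y2 : nat) :
  (x0 < b -> x1 < b -> x2 < b -> y0 < b -> y1 < b -> y2 < b ->
   (x2 * b + x1) * b + x0 = (y2 * b + y1) * b + y0 ->
   [/\ x0 = y0, x1 = y1 & x2 = y2])%N.
Proof.
move=> hx0 hx1 hx2 hy0 hy1 hy2 e.
have b0 : (0 < b)%N by apply: leq_ltn_trans hx0.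
have e0 : x0 = y0.
  by have := congr1 (modn^~ b) e; rewrite !modnMDl !modn_small.
move: e; rewrite e0 => /addIn/eqP; rewrite eqn_pmul2r // => /eqP e.
have e1 : x1 = y1.
  by have := congr1 (modn^~ b) e; rewrite !modnMDl !modn_small.
by move: e; rewrite e1 => /addIn/eqP; rewrite eqn_pmul2r // => /eqP e2.
Qed.

(* Kronecker's substitution reduces the claim to one variable. *)
Lemma mpoly_nonroot (f : {mpoly K[3]}) : f != 0 -> exists x, ev f x != 0.
Proof.
(* [msize f] exceeds every exponent in the support of [f], so the exponents are digits in base
   [b]. *)
move=> f0; pose b := msize f.
pose i0 : 'I_3 := ord0; pose i1 : 'I_3 := inord 1; pose i2 : 'I_3 := inord 2.
pose code (m : 'X_{1..3}) := ((m i2 * b + m i1) * b + m i0)%N.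
have ltb m i : m \in msupp f -> (m i < b)%N.
  move=> mf; apply: leq_ltn_trans (msize_mdeg_lt mf).
  by rewrite mdegE (bigD1 i) //= leq_addr.
have code_inj : {in msupp f &, injective code}.
  move=> m m' mf mf' /base_digits_inj [] //; rewrite ?ltb //.
  move=> e0 e1 e2; apply/mnmP => i.
  case: i => -[|[|[|//]]] hi.
  - by rewrite (_ : Ordinal hi = i0) //; apply: val_inj.
  - by rewrite (_ : Ordinal hi = i1) //; apply: val_inj; rewrite /= inordK.
  - by rewrite (_ : Ordinal hi = i2) //; apply: val_inj; rewrite /= inordK.
pose q : {poly K} := \sum_(m <- msupp f) f@_m *: 'X^(code m).
have q0 : q != 0.
  apply/eqP => /(congr1 (fun p : {poly K} => p`_(code (mlead f)))).
  rewrite coef0 coef_sum (bigD1_seq (mlead f)) ?msupp_uniq ?mlead_supp //=.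
  rewrite coefZ coefXn eqxx mulr1 big_seq_cond big1 ?addr0; last first.
    move=> m /andP[mf ne]; rewrite coefZ coefXn.
    rewrite (inj_in_eq code_inj) ?mlead_supp //.
    by rewrite eq_sym (negbTE ne) mulr0.
  by move/eqP; rewrite mleadc_eq0 (negbTE f0).
have /closed_nonrootP[t qt] := q0.
(* At the point [(t, t ^ b, t ^ (b * b))], the value of [f] is that of [q] at [t]. *)
exists (\row_i t ^+ (if i == i0 then 1 else if i == i1 then b else b * b)%N).
apply: contra qt => /eqP ft; apply/eqP; rewrite -ft /ev mevalE horner_sum.
apply: eq_bigr => m _; rewrite hornerZ hornerXn; congr (_ * _).
rewrite !big_ord_recl big_ord0 mulr1 !mxE.
rewrite (_ : lift ord0 ord0 = i1); last by apply: val_inj; rewrite /= inordK.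
rewrite (_ : lift ord0 (lift ord0 ord0) = i2); last by apply: val_inj; rewrite /= inordK.
have -> : (i1 == i0) = false by rewrite -val_eqE /= inordK.
have -> : (i2 == i0) = false by rewrite -val_eqE /= inordK.
have -> : (i2 == i1) = false by rewrite -val_eqE /= !inordK.
rewrite !eqxx -!exprM -!exprD; congr (_ ^+ _); rewrite /code; ring.
Qed.
End NonVanishing.

(** * Coordinates on the space of forms of degree [k] *)

Section Monomials.
Variables (R : fieldType) (k : nat).

Definition monomials : seq 'X_{1..3} :=
  [seq s2m t | t : k.-tuple 'I_3 <- enum (basis 3 k)].

Lemma size_monomials : size monomials = 'C(k + 2, k).
Proof. exact: size_basis. Qed.

Definition mon (i : 'I_('C(k + 2, k))) : 'X_{1..3} := nth 0%MM monomials i.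

Lemma mdeg_mon i : mdeg (mon i) = k.
Proof.
by apply/eqP; rewrite basis_cover mem_nth // size_monomials.
Qed.

Lemma mon_homog i : ('X_[mon i] : {mpoly R[3]}) \is k.-homog.
Proof. by rewrite dhomogX /= mdeg_mon. Qed.

Lemma mon_inj : injective mon.
Proof.
move=> i j /eqP; rewrite nth_uniq ?size_monomials ?uniq_basis //.
by move/eqP/val_inj.
Qed.

Lemma mon_surj m : mdeg m = k -> exists i, mon i = m.
Proof.
move=> /eqP; rewrite basis_cover => mm.
have im : (index m monomials < 'C(k + 2, k))%N by rewrite -size_monomials index_mem.
by exists (Ordinal im); rewrite /mon nth_index.
Qed.

Definition form (c : 'rV[R]_('C(k + 2, k))) : {mpoly R[3]} :=
  \sum_i c 0 i *: 'X_[mon i].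

Lemma mcoeff_form c i : (form c)@_(mon i) = c 0 i.
Proof.
rewrite raddf_sum (bigD1 i) //= mcoeffZ mcoeffX eqxx mulr1 big1 ?addr0 // => j ne.
by rewrite mcoeffZ mcoeffX (inj_eq mon_inj) (negbTE ne) mulr0.
Qed.

Lemma form_homog c : form c \is k.-homog.
Proof. by apply: rpred_sum => i _; apply/dhomogZ/mon_homog. Qed.

Lemma form_eq0 c : (form c == 0) = (c == 0).
Proof.
apply/eqP/eqP => [f0|->]; last by rewrite /form big1 // => i _; rewrite mxE scale0r.
by apply/rowP => i; rewrite -mcoeff_form f0 mcoeff0 mxE.
Qed.

Lemma homog_form f : f \is k.-homog -> exists c, f = form c.
Proof.
move=> fk; exists (\row_i f@_(mon i)); apply/mpolyP => m.
have [mk|mk] := eqVneq (mdeg m) k.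
  by have [i <-] := mon_surj mk; rewrite mcoeff_form mxE.
by rewrite !(dhomog_nemf_coeff _ mk) ?form_homog.
Qed.
End Monomials.

(** The matrix factors through the coordinate vectors indexed by [S]. *)
Lemma mxrank_le_supp (R : fieldType) N n (A : 'M[R]_(N, n)) (S : {set 'I_n}) :
  (forall i j, j \notin S -> A i j = 0) -> (\rank A <= #|S|)%N.
Proof.
move=> A0.
pose E : 'M[R]_(#|S|, n) := \matrix_(a, j) (enum_val a == j)%:R.
have -> : A = (\matrix_(i, a) A i (enum_val a)) *m E.
  apply/matrixP => i j; rewrite !mxE.
  have [jS|jS] := boolP (j \in S); last first.
    rewrite A0 // big1 // => a _; rewrite !mxE.
    by case: eqP => [aj|_]; rewrite ?mulr0 //; move: jS; rewrite -aj enum_valP.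
  rewrite (bigD1 (enum_rank_in jS j)) //= !mxE enum_rankK_in // eqxx mulr1.
  rewrite big1 ?addr0 // => a ne; rewrite !mxE; case: eqP => [aj|_]; rewrite ?mulr0 //.
  by case/eqP: ne; apply: enum_val_inj; rewrite enum_rankK_in.
exact: leq_trans (mxrankM_maxr _ _) (rank_leq_row _).
Qed.

(** * Evaluation matrices and Hilbert functions of point sets *)

Section Evaluation.
Variables (R : fieldType) (n : nat) (P : 'I_n -> 'rV[R]_3).
Implicit Types (S T : {set 'I_n}) (f : {mpoly R[3]}) (k : nat).

(** Coordinates off [S] are zeroed rather than deleted, so that all subsets share one ambient
    space. *)
Definition evalr S f : 'rV[R]_n := \row_j ((j \in S)%:R * ev f (P j)).

Definition evalmx k S : 'M[R]_('C(k + 2, k), n) :=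
  \matrix_i evalr S 'X_[mon i].

(** This rank is the codimension, among the forms of degree [k], of those vanishing on [S]. *)
Definition hilbert k S : nat := \rank (evalmx k S).

Lemma evalr_form k S c : evalr S (@form R k c) = c *m evalmx k S.
Proof.
apply/rowP => j; rewrite !mxE ev_sum mulr_sumr; apply: eq_bigr => i _.
by rewrite evZ !mxE mulrCA.
Qed.

Lemma evalr_sub k S f : f \is k.-homog -> (evalr S f <= evalmx k S)%MS.
Proof. by move=> /homog_form[c ->]; rewrite evalr_form submxMl. Qed.

Lemma evalr_eq0 S f : reflect (forall i, i \in S -> ev f (P i) = 0) (evalr S f == 0).
Proof.
apply: (iffP eqP) => [/rowP f0 i iS|f0].
  by have := f0 i; rewrite !mxE iS mul1r.
by apply/rowP => i; rewrite !mxE; case: (boolP (i \in S)) => [/f0 ->|_]; rewrite (mulr0, mul0r).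
Qed.

(** Vectors in the left kernel of the evaluation matrix are the coefficients of the forms vanishing
    on [S]. *)
Lemma lie_on_curveP k S : reflect (lie_on_curve k P S) (hilbert k S < 'C(k + 2, k))%N.
Proof.
have -> : (hilbert k S < 'C(k + 2, k))%N = ~~ row_free (evalmx k S).
  by rewrite /row_free ltn_neqAle rank_leq_row andbT.
rewrite -kermx_eq0; apply: (iffP rowV0Pn) => [[c /sub_kermxP cE c0]|].
  exists (form c); first by split; rewrite ?form_eq0 ?form_homog.
  by apply/evalr_eq0; rewrite evalr_form cE.
move=> [f [f0 /homog_form[c fE]]] /evalr_eq0; rewrite fE evalr_form => /eqP cE.
by exists c; [apply/sub_kermxP | rewrite -form_eq0 -fE].
Qed.

Lemma hilbert_le_card k S : (hilbert k S <= #|S|)%N.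
Proof. by apply: mxrank_le_supp => i j jS; rewrite !mxE (negbTE jS) mul0r. Qed.

Lemma lie_on_curve_small k S : (#|S| < 'C(k + 2, k))%N -> lie_on_curve k P S.
Proof. by move=> lt; apply/lie_on_curveP; apply: leq_ltn_trans lt; apply: hilbert_le_card. Qed.

Lemma lie_on_curveS k S T : S \subset T -> lie_on_curve k P T -> lie_on_curve k P S.
Proof. by move=> /subsetP sST [C Ck CT]; exists C => // i /sST; apply: CT. Qed.

Lemma lie_on_curveU k l S T :
  lie_on_curve k P S -> lie_on_curve l P T -> lie_on_curve (k + l) P (S :|: T).
Proof.
move=> [C [C0 Ck] CS] [D [D0 Dl] DT]; exists (C * D).
  by split; rewrite ?mulf_neq0 ?dhomogM.
by move=> i /setUP[/CS|/DT]; rewrite evM => ->; rewrite (mulr0, mul0r).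
Qed.
End Evaluation.

Lemma subset_of_card (I : finType) (S : {set I}) t : (t <= #|S|)%N ->
  exists T : {set I}, T \subset S /\ #|T| = t.
Proof.
rewrite -bin_gt0 -cards_draws => /card_gt0P[T]; rewrite inE => /andP[sT /eqP cT].
by exists T.
Qed.

(** * Linear relations between evaluations *)

Section Relations.
Variables (R : fieldType) (n : nat) (P : 'I_n -> 'rV[R]_3).
Implicit Types (S T : {set 'I_n}) (f : {mpoly R[3]}) (k m : nat) (y z : 'rV[R]_n).

Definition supp y : {set 'I_n} := [set j | y 0 j != 0].

Definition relation m y : Prop :=
  forall f, f \is m.-homog -> \sum_j ev f (P j) * y 0 j = 0.

Lemma supp_eq0 y : (supp y == set0) = (y == 0).
Proof.
apply/eqP/eqP => [s0|->]; last by apply/setP => j; rewrite !inE mxE eqxx.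
by apply/rowP => j; apply/eqP; have := in_set0 j; rewrite -s0 inE mxE => /negbFE.
Qed.

Lemma relation_mul m k f y : f \is k.-homog -> (k <= m)%N -> relation m y ->
  exists2 z, relation (m - k) z & supp z = [set j in supp y | ev f (P j) != 0].
Proof.
move=> fk km ry; exists (\row_j (ev f (P j) * y 0 j)).
  move=> g gmk; rewrite -[RHS](ry (g * f)); last first.
    by rewrite -(subnK km) dhomogM.
  by apply: eq_bigr => j _; rewrite mxE evM mulrA.
by apply/setP => j; rewrite !inE mxE mulf_eq0 negb_or andbC.
Qed.

(* Multiplying by the equation of the curve through [T]. *)
Lemma residual m k y T : relation m y -> (k <= m)%N -> T \subset supp y ->
    lie_on_curve k P T ->
  exists z, [/\ relation (m - k) z, supp z \subset supp y :\: T
    & lie_on_curve k P (supp y :\: supp z)].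
Proof.
move=> ry km /subsetP sT [C [C0 Ck] CT]; have [z rz sz] := relation_mul Ck km ry.
exists z; split=> //.
  apply/subsetP => j; rewrite sz in_set in_setD => /andP[-> Cj]; rewrite andbT.
  by apply: contra Cj => /CT ->.
exists C => // j; rewrite in_setD sz in_set => /andP[] /[swap] ->.
by rewrite /= negbK => /eqP.
Qed.

Lemma evalmx_relation k y S : supp y \subset S ->
  evalmx P k S *m y^T = 0 -> relation k y.
Proof.
move=> /subsetP yS ey f /homog_form[c ->].
have := congr1 (fun A => (c *m A) 0 0) ey; rewrite mulmxA -evalr_form mulmx0 !mxE => e0.
rewrite -[RHS]e0; apply: eq_bigr => j _; rewrite !mxE.
have [jS|jS] := boolP (j \in S); first by rewrite mul1r.
by have := contra (yS j) jS; rewrite inE negbK => /eqP ->; rewrite !mulr0.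
Qed.

(** If the rank were below [t], the evaluations at any [t] points of [S] would be dependent, and a
    dependency is a nonzero relation. *)
Lemma hilbert_ge k S t : (t <= #|S|)%N ->
  (forall y, relation k y -> supp y \subset S -> (#|supp y| <= t)%N -> y = 0) ->
  (t <= hilbert P k S)%N.
Proof.
move=> tS indep; rewrite leqNgt; apply/negP => lt_ht.
have [T [sTS cT]] : exists T : {set 'I_n}, T \subset S /\ #|T| = t.
  exact: subset_of_card.
pose E : 'M[R]_(#|T|, n) := \matrix_(a, j) (enum_val a == j)%:R.
have : ~~ row_free (E *m (evalmx P k S)^T).
  apply/negP => /eqP rE; move: lt_ht; rewrite -{1}cT -rE ltnNge.
  by rewrite /hilbert -(mxrank_tr (evalmx P k S)) mxrankM_maxr.
rewrite -kermx_eq0 => /rowV0Pn[c /sub_kermxP cE] /eqP; case.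
have yE a : (c *m E) 0 (enum_val a) = c 0 a.
  rewrite mxE (bigD1 a) //= mxE eqxx mulr1 big1 ?addr0 // => b ne.
  by rewrite mxE (inj_eq enum_val_inj) (negbTE ne) mulr0.
have sT : supp (c *m E) \subset T.
  apply/subsetP => j; rewrite inE; apply: contraR => jT; rewrite mxE big1 // => a _.
  by rewrite mxE; case: eqP => [aj|_]; rewrite ?mulr0 //; move: jT; rewrite -aj enum_valP.
have y0 : c *m E = 0.
  apply: indep; last by rewrite -cT subset_leq_card.
    apply: (@evalmx_relation _ _ S); first exact: subset_trans sTS.
    by apply: trmx_inj; rewrite trmx_mul trmxK -mulmxA cE trmx0.
  exact: subset_trans sTS.
by apply/rowP => a; rewrite -yE y0 !mxE.
Qed.

(* The evaluations of the forms of degrees [i] and [m - i] are orthogonal for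
   the bilinear form with Gram matrix [diag_mx y]. *)
Lemma hilbert_duality m i y : relation m y -> (i <= m)%N ->
  (hilbert P i (supp y) + hilbert P (m - i) (supp y) <= #|supp y|)%N.
Proof.
move=> ry im; set S := supp y; set A := evalmx P i S; set B := evalmx P (m - i) S.
(* Since [y] is invertible on its support and the other columns vanish, multiplication by
   [diag_mx y] preserves the rank. *)
have evS k : evalmx P k S = evalmx P k S *m diag_mx y *m diag_mx (\row_j (y 0 j)^-1).
  apply/matrixP => a j; rewrite !mul_mx_diag !mxE.
  have [yj|yj] := eqVneq (y 0 j) 0; last by rewrite mulfK.
  by rewrite inE yj eqxx !mul0r.
have rkS k : hilbert P k S = \rank (evalmx P k S *m diag_mx y).
  by apply/eqP; rewrite eqn_leq mxrankM_maxl andbT /hilbert {1}evS mxrankM_maxl.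
rewrite !rkS -[\rank (B *m _)]mxrank_tr trmx_mul tr_diag_mx.
(* Frobenius' inequality with [diag_mx y] in the middle: the triple product vanishes by the
   relation, and the middle rank is at most the weight. *)
apply: leq_trans (mxrank_Frobenius _ _ _) _.
have -> : A *m diag_mx y *m B^T = 0.
  apply/matrixP => a b; rewrite mul_mx_diag !mxE.
  rewrite -[RHS](ry ('X_[mon a] * 'X_[mon b])); last first.
    by have := dhomogM (mon_homog R a) (mon_homog R b); rewrite subnKC.
  apply: eq_bigr => j _; rewrite !mxE evM.
  have [yj|yj] := eqVneq (y 0 j) 0; first by rewrite yj mulr0 mul0r mulr0.
  by rewrite inE yj !mul1r mulrAC.
rewrite mxrank0 addn0.
by apply: mxrank_le_supp => a j; rewrite inE negbK !mxE => /eqP yj; case: eqP => [->|_] //; rewrite yj.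
Qed.
End Relations.

(** * Relations of small weight and collinearity *)

Section Lines.
Variables (R : fieldType) (n : nat) (P : 'I_n -> 'rV[R]_3).
Hypothesis ptsP : projective_points P.
Implicit Types (S T : {set 'I_n}) (k m : nat) (y z : 'rV[R]_n).

Lemma linear_homog (a b : R) (i j : 'I_3) : a *: 'X_i - b *: 'X_j \is 1.-homog.
Proof. by apply: dhomogD; rewrite ?dhomogN; apply: dhomogZ; rewrite dhomogX /= mdeg1. Qed.

(** Distinct points have nonproportional coordinates, so some minor is nonzero; as a function of the
    second point it is a linear form. *)
Lemma separating_line p q : p != q ->
  exists f : {mpoly R[3]}, [/\ f \is 1.-homog, ev f (P p) = 0 & ev f (P q) != 0].
Proof.
move=> pq; have [P0 Pinj] := ptsP.
have /rV0Pn[k pk] := P0 p.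
have [j qj] : exists j, P p 0 k * P q 0 j - P p 0 j * P q 0 k != 0.
  apply/existsP; apply: contraNT pq => /existsPn qp; apply/eqP/esym.
  apply: (Pinj q p (P q 0 k / P p 0 k)).
  apply/rowP => j; rewrite mxE; have := qp j; rewrite negbK subr_eq0 => /eqP e.
  by apply: (mulfI pk); rewrite e; field.
exists (P p 0 k *: 'X_j - P p 0 j *: 'X_k); split; first exact: linear_homog.
  by rewrite evB !evZ !evX mulrC subrr.
by rewrite evB !evZ !evX.
Qed.

(** By induction: a line through one support point [p] and missing another, [q], lowers the degree
    by one, loses a point and keeps the relation nonzero. *)
Lemma relation_card m y : relation P m y -> y != 0 -> (m + 2 <= #|supp y|)%N.
Proof.
elim: m y => [|m IHm] y ry y0.
  rewrite add0n ltnNge; apply/negP => /card_le1_eqP s1.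
  move: y0; rewrite -supp_eq0 => /set0Pn[p ps]; move: (ps); rewrite inE => /eqP; case.
  have := ry 1; rewrite dhomog1 => /(_ isT); rewrite (bigD1 p) //= big1 => [|j jp].
    by rewrite /ev meval1 mul1r addr0.
  have [->|yj] := eqVneq (y 0 j) 0; first by rewrite mulr0.
  by case/eqP: jp; apply: s1 => //; rewrite inE.
have lt0m : (0 < m.+1)%N by [].
have /set0Pn[p ps] : supp y != set0 by rewrite supp_eq0.
have [P0 _] := ptsP.
have [/exists_inP[q qs qp]|/exists_inPn sp] := boolP [exists q in supp y, q != p].
  have [f [f1 fp fq]] : exists f : {mpoly R[3]}, [/\ f \is 1.-homog, ev f (P p) = 0 & ev f (P q) != 0].
    by apply: separating_line; rewrite eq_sym.
  have [z rz sz] := relation_mul f1 lt0m ry; rewrite subn1 /= in rz.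
  have z0 : z != 0 by rewrite -supp_eq0; apply/set0Pn; exists q; rewrite sz inE qs.
  have /proper_card : supp z \proper supp y.
    apply/properP; split; first by apply/subsetP => j; rewrite sz inE => /andP[].
    by exists p => //; rewrite sz inE fp eqxx andbF.
  by have := IHm _ rz z0; lia.
(* If [p] is the only support point, a coordinate nonzero at [p] lowers the degree and keeps the
   support, against the induction hypothesis. *)
have /rV0Pn[k pk] := P0 p.
have X1 : ('X_k : {mpoly R[3]}) \is 1.-homog by rewrite dhomogX /= mdeg1.
have [z rz sz] := relation_mul X1 lt0m ry; rewrite subn1 /= in rz.
have z0 : z != 0 by rewrite -supp_eq0; apply/set0Pn; exists p; rewrite sz inE ps evX.
have := IHm _ rz z0; rewrite addn2 => /(leq_trans _) => /(_ 2 isT).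
rewrite ltnNge => /negP; case; apply/card_le1_eqP => i j.
have szp l : l \in supp z -> l = p.
  by rewrite sz inE => /andP[/sp]; rewrite negbK => /eqP.
by move=> /szp -> /szp ->.
Qed.

Lemma relation_eq0 m y : relation P m y -> (#|supp y| < m + 2)%N -> y = 0.
Proof.
move=> ry; apply: contraTeq => y0; rewrite -leqNgt; exact: relation_card y0.
Qed.

Lemma residual_on k l y z : lie_on_curve k P (supp y :\: supp z) ->
  lie_on_curve l P (supp z) -> lie_on_curve (k + l) P (supp y).
Proof.
move=> h1 h2; apply: lie_on_curveS (lie_on_curveU h1 h2).
by apply/subsetP => j; rewrite !inE => ->; rewrite andbT orNb.
Qed.

Lemma residual_all k y z : z = 0 -> lie_on_curve k P (supp y :\: supp z) ->
  lie_on_curve k P (supp y).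
Proof. by move=> ->; rewrite (_ : supp 0 = set0) ?setD0 //; apply/eqP; rewrite supp_eq0. Qed.

(** The residual of a line through two support points is collinear by induction. If it is nonzero,
    it has so many points that the residual of its own line is too small to be nonzero. *)
Lemma relation_collinear m y : relation P m y -> (#|supp y| <= 2 * m + 1)%N ->
  lie_on_curve 1 P (supp y).
Proof.
elim: m y => [|m IHm] y ry cy; first by apply: lie_on_curve_small; apply: leq_ltn_trans cy _.
have [c2|c2] := ltnP #|supp y| 3; first exact: lie_on_curve_small.
have [T [sT cT]] := subset_of_card (ltnW c2).
have lT : lie_on_curve 1 P T by apply: lie_on_curve_small; rewrite cT.
have [z [rz sz lz]] := residual ry (ltn0Sn m) sT lT; rewrite subn1 /= in rz.
have cz := subset_leq_card sz; rewrite cardsDS // cT in cz.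
have [z0|z0] := eqVneq z 0; first exact: residual_all z0 lz.
have lz' : lie_on_curve 1 P (supp z) by apply: IHm rz _; lia.
have szy : supp z \subset supp y by apply: subset_trans sz (subsetDl _ _).
have [w [rw sw lw]] := residual ry (ltn0Sn m) szy lz'; rewrite subn1 /= in rw.
have cw := subset_leq_card sw; rewrite cardsDS // in cw.
apply: residual_all lw; apply: (relation_eq0 rw).
by have := relation_card rz z0; lia.
Qed.
End Lines.

(** * Forms modulo two lines *)

Section ThreeLines.
Variables (R : fieldType) (u v w : {mpoly R[3]}).
Hypothesis X_span : forall i, exists a b c, 'X_i = a *: u + b *: v + c *: w :> {mpoly R[3]}.
Hypothesis w1 : w \is 1.-homog.

(** Modulo [u] and [v], every linear form is a multiple of [w], so each degree is spanned by a power
    of [w]. *)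
Lemma homog_mod_lines k f : f \is k.+1.-homog ->
  exists g h c, [/\ g \is k.-homog, h \is k.-homog & f = u * g + v * h + c *: w ^+ k.+1].
Proof.
elim: k f => [|k IHk] f fk.
  have [g g0 ->] := dhomog_mulX fk.
  have gC i : exists c, g i = c%:MP.
    have [c ->] := homog_form (g0 i); rewrite /form.
    have m0 j : @mon 0 j = 0%MM :> 'X_{1..3}.
      by apply/eqP; rewrite -mdeg_eq0 mdeg_mon.
    exists (\sum_j c 0 j); rewrite -alg_mpolyC scaler_suml; apply: eq_bigr => j _.
    by rewrite m0 mpolyX0.
  apply: (big_ind (fun f => exists g h c, [/\ g \is 0.-homog, h \is 0.-homog &
     f = u * g + v * h + c *: w ^+ 1])).
  - by exists 0, 0, 0; split; rewrite ?dhomog0 // !mulr0 scale0r !addr0.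
  - move=> f1 f2 [g1 [h1 [c1 [? ? ->]]]] [g2 [h2 [c2 [? ? ->]]]].
    exists (g1 + g2), (h1 + h2), (c1 + c2); split; rewrite ?dhomogD //.
    by rewrite scalerDl; ring.
  move=> i _; have [c ->] := gC i; have [a [b [d ->]]] := X_span i.
  exists (a * c)%:MP, (b * c)%:MP, (d * c); split.
  - by rewrite -alg_mpolyC dhomogZ // dhomog1.
  - by rewrite -alg_mpolyC dhomogZ // dhomog1.
  - by rewrite expr1 -!mul_mpolyC !mpolyCM; ring.
have [g gk ->] := dhomog_mulX fk.
apply: (big_ind (fun f => exists g h c, [/\ g \is k.+1.-homog, h \is k.+1.-homog &
   f = u * g + v * h + c *: w ^+ k.+2])).
- by exists 0, 0, 0; split; rewrite ?dhomog0 // !mulr0 scale0r !addr0.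
- move=> f1 f2 [g1 [h1 [c1 [? ? ->]]]] [g2 [h2 [c2 [? ? ->]]]].
  exists (g1 + g2), (h1 + h2), (c1 + c2); split; rewrite ?dhomogD //.
  by rewrite scalerDl; ring.
move=> i _; have [g1 [h1 [c1 [g1k h1k gE]]]] := IHk _ (gk i).
have [a [b [d XE]]] := X_span i.
exists (a *: g i + d *: (w * g1)), (b *: g i + d *: (w * h1)), (d * c1); split.
- by rewrite dhomogD // dhomogZ // (dhomogM w1 g1k).
- by rewrite dhomogD // dhomogZ // (dhomogM w1 h1k).
by rewrite XE mulrDl {2}gE -!mul_mpolyC !mpolyCM [w ^+ k.+2]exprS; ring.
Qed.
End ThreeLines.

(** * Macaulay's bound *)

Section Macaulay.
Variables (K : closedFieldType) (n : nat) (P : 'I_n -> 'rV[K]_3).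
Hypothesis P0 : forall j, P j != 0.
Implicit Types (S : {set 'I_n}) (f g : {mpoly K[3]}).

Lemma evalrD S f g : evalr P S (f + g) = evalr P S f + evalr P S g.
Proof. by apply/rowP => j; rewrite !mxE evD mulrDr. Qed.

Lemma evalrM S f g :
  evalr P S (f * g) = evalr P S g *m diag_mx (\row_j ev f (P j)).
Proof. by apply/rowP => j; rewrite mul_mx_diag !mxE evM; ring. Qed.

(** The forms [u] and [v] span the pencil of lines through [Q]. Each point of [S] lies on only one
    of these lines, so over an infinite field some member avoids [S]. *)
Lemma lines_through Q S : Q != 0 ->
    (forall j c, j \in S -> P j != c *: Q) ->
  exists u v w : {mpoly K[3]},
  [/\ [/\ u \is 1.-homog, v \is 1.-homog & w \is 1.-homog],
      ev u Q = 0, ev v Q = 0,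
      forall i, exists a b c, 'X_i = a *: u + b *: v + c *: w :> {mpoly K[3]}
    & forall j, j \in S -> ev u (P j) != 0].
Proof.
move=> /rV0Pn[i0 Q0] SQ.
pose d j : {mpoly K[3]} := Q 0 i0 *: 'X_j - Q 0 j *: 'X_i0.
have X1 i : ('X_i : {mpoly K[3]}) \is 1.-homog by rewrite dhomogX /= mdeg1.
have d1 j : d j \is 1.-homog by apply: dhomogD; rewrite ?dhomogN dhomogZ.
have dQ j : ev (d j) Q = 0 by rewrite evB !evZ !evX mulrC subrr.
pose a := lift i0 (0 : 'I_2); pose b := lift i0 (1 : 'I_2).
have allI i : [\/ i = i0, i = a | i = b].
  case: (unliftP i0 i) => [c ->|->]; last by constructor 1.
  case: c => -[|[|//]] hc; [constructor 2 | constructor 3];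
    by congr (lift i0 _); apply: val_inj.
have XE j : 'X_j = (Q 0 i0)^-1 *: d j + (Q 0 j / Q 0 i0) *: 'X_i0.
  rewrite /d scalerBr !scalerA mulVf // scale1r [_^-1 * _]mulrC subrK //.
have di0 : d i0 = 0 by rewrite /d subrr.
clearbody d.
have [t ut] : exists t, forall j, j \in S -> ev (d a + t *: d b) (P j) != 0.
  (* The roots of [p] are the parameters of the lines of the pencil that meet [S]. *)
  pose p : {poly K} := \prod_(j in S) ((ev (d a) (P j))%:P + ev (d b) (P j) *: 'X).
  have p0 : p != 0.
    apply/prodf_neq0 => j jS; apply/eqP => pj.
    have da : ev (d a) (P j) = 0.
      by have := congr1 (fun q : {poly K} => q`_0) pj; rewrite coefD coefC coefZ coefX mulr0 addr0 coef0.
    have db : ev (d b) (P j) = 0.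
      by have := congr1 (fun q : {poly K} => q`_1) pj; rewrite coefD coefC coefZ coefX mulr1 add0r coef0.
    have dj i : ev (d i) (P j) = 0.
      have [->|->|->] := allI i => //; by rewrite di0 /ev meval0.
    case/eqP: (SQ j (P j 0 i0 / Q 0 i0) jS); apply/rowP => i; rewrite mxE.
    rewrite -[LHS]evX XE evD !evZ dj mulr0 add0r evX; ring.
  have /closed_nonrootP[t rt] := p0; exists t => j jS.
  move: rt; rewrite /root horner_prod => /prodf_neq0/(_ j jS).
  by rewrite hornerD hornerC hornerZ hornerX evD evZ mulrC.
exists (d a + t *: d b), (d b), 'X_i0; split=> //.
- by split=> //; rewrite dhomogD // dhomogZ.
- by rewrite evD evZ !dQ mulr0 addr0.
move=> i; have [->|->|->] := allI i.
- by exists 0, 0, 1; rewrite !scale0r scale1r !add0r.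
- exists (Q 0 i0)^-1, (- (t / Q 0 i0)), (Q 0 a / Q 0 i0).
  by rewrite {1}XE scalerDr scalerA scaleNr [t / _]mulrC addrK.
exists 0, (Q 0 i0)^-1, (Q 0 b / Q 0 i0); by rewrite {1}XE scale0r add0r.
Qed.

(* Macaulay's bound for the quotient of the coordinate ring by a line avoiding
   the points: once its Hilbert function, the first difference of [hilbert], falls
   below that of a polynomial ring in two variables, it is nonincreasing. *)
Lemma hilbert_macaulay_closed k S : (hilbert P k.+1 S < 'C(k.+1 + 2, k.+1))%N ->
  (hilbert P k.+2 S + hilbert P k S <= hilbert P k.+1 S + hilbert P k.+1 S)%N.
Proof.
move=> /lie_on_curveP[G [G0 Gk] GS].
have [Q GQ] := mpoly_nonroot G0.
have Q0 : Q != 0.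
  apply: contraNneq GQ => ->; rewrite -(scale0r 0).
  by rewrite (dhomog_homothety _ _ Gk) exprS !mul0r.
have SQ j c : j \in S -> P j != c *: Q.
  move=> jS; apply/eqP => PQ; have := GS _ jS; rewrite PQ (dhomog_homothety _ _ Gk).
  move/eqP; rewrite mulf_eq0 (negbTE GQ) orbF expf_eq0 /= => /eqP c0.
  by have := P0 j; rewrite PQ c0 scale0r eqxx.
have [u [v [w [[u1 v1 w1] uQ vQ Xs uS]]]] := lines_through Q0 SQ.
have [g' [h' [c' [g'k h'k GE]]]] := homog_mod_lines Xs w1 Gk.
(* Since [u] and [v] vanish at [Q] but [G] does not, [G] involves [w ^+ k.+1] and can be used to
   eliminate powers of [w] on [S]. *)
have c'0 : c' != 0.
  apply: contraNneq GQ => c'0.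
  by rewrite GE c'0 scale0r addr0 evD !evM uQ vQ !mul0r addr0.
set L := diag_mx (\row_j ev u (P j)); set Y := diag_mx (\row_j ev v (P j)).
set V := fun k => evalmx P k S.
have VL i : (V i *m L <= V i.+1)%MS.
  apply/row_subP => a; rewrite row_mul rowK -evalrM; apply: evalr_sub.
  exact/dhomog1M/mon_homog.
have VY i : (V i *m Y <= V i.+1)%MS.
  apply/row_subP => a; rewrite row_mul rowK -evalrM; apply: evalr_sub.
  exact/dhomog1M/mon_homog.
have Vsum : (V k.+2 <= V k.+1 *m L + V k.+1 *m Y)%MS.
  apply/row_subP => a; rewrite rowK.
  have fk := mon_homog K a.
  have [g [h [c [gk hk fE]]]] := homog_mod_lines Xs w1 fk.
  have G'S : evalr P S ((- (c / c')) *: (w * G)) = 0.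
    by apply/eqP/evalr_eq0 => j jS; rewrite evZ evM GS // !mulr0.
  pose s := - (c / c').
  have -> : evalr P S 'X_[mon a] =
      evalr P S (u * (g + s *: (w * g')) + v * (h + s *: (w * h'))).
    rewrite -[LHS]addr0 -G'S -evalrD; congr (evalr P S _).
    rewrite fE GE -/s.
    have -> : c *: w ^+ k.+2 = - s *: (c' *: (w * w ^+ k.+1)).
      by rewrite scalerA -exprS /s opprK divfK.
    by rewrite -!mul_mpolyC mpolyCN; ring.
  rewrite evalrD !evalrM; apply: addmx_sub_adds; apply: submxMr; apply: evalr_sub.
    by rewrite dhomogD // dhomogZ // dhomog1M.
  by rewrite dhomogD // dhomogZ // dhomog1M.
have rkL : \rank (V k *m L) = hilbert P k S.
  apply/eqP; rewrite eqn_leq mxrankM_maxl /=.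
  have {1}-> : hilbert P k S = \rank (V k *m L *m diag_mx (\row_j (ev u (P j))^-1)).
    congr (\rank _); apply/matrixP => i j; rewrite !mul_mx_diag !mxE.
    by have [jS|jS] := boolP (j \in S); rewrite ?mul0r // mulfK ?uS.
  exact: mxrankM_maxl.
(* [U] complements [V k *m L] in [V k.+1], so its rank is the first difference. Multiplying
   [V k *m L] by [v] stays inside [V k.+1 *m L], hence only [U *m Y] adds to the latter in degree
   [k.+2]. *)
pose U := (V k.+1 :\: V k *m L)%MS.
have VU : (V k.+1 <= V k *m L + U)%MS.
  apply: (@submx_trans _ _ _ _ _ _ (U + (V k.+1 :&: V k *m L))%MS).
    by rewrite addsmx_diff_cap_eq.
  by rewrite addsmxC addsmxS // capmxSr.
have rkU : (\rank U + hilbert P k S = hilbert P k.+1 S)%N.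
  rewrite -[hilbert P k.+1 S](mxrank_cap_compl (V k.+1) (V k *m L)) addnC; congr (_ + _)%N.
  by rewrite -rkL; apply/esym/eqmx_rank; rewrite capmxSr sub_capmx submx_refl VL.
have : (V k.+2 <= V k.+1 *m L + U *m Y)%MS.
  apply: submx_trans Vsum _; rewrite addsmx_sub addsmxSl /=.
  apply: submx_trans (submxMr _ VU) _; rewrite addsmxMr addsmx_sub addsmxSr andbT.
  rewrite -mulmxA (_ : L *m Y = Y *m L); last by rewrite diag_mxC.
  by rewrite mulmxA; apply: submx_trans (submxMr _ (VY k)) (addsmxSl _ _).
move=> /mxrankS; have := mxrank_adds_leqif (V k.+1 *m L) (U *m Y); case=> + _.
have := mxrankM_maxl (V k.+1) L; have := mxrankM_maxl U Y.
rewrite -/(hilbert P k.+1 S) -/(hilbert P k.+2 S); lia.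
Qed.
End Macaulay.

(** * Supports on conics and cubics *)

Section PlanePoints.
Variables (R : fieldType) (K : closedFieldType) (iota : {rmorphism R -> K}).
Variables (n : nat) (P : 'I_n -> 'rV[R]_3).
Hypothesis ptsP : projective_points P.
Implicit Types (S T : {set 'I_n}) (k m : nat) (y z : 'rV[R]_n).

(** Ranks are invariant under field extension; over [K] there are enough lines to avoid the
    points. *)
Lemma hilbert_map k S : hilbert (fun j => map_mx iota (P j)) k S = hilbert P k S.
Proof.
rewrite /hilbert -(mxrank_map iota); congr (\rank _); apply/matrixP => i j.
rewrite !mxE rmorphM rmorph_nat /ev !mevalX rmorph_prod; congr (_ * _).
by apply: eq_bigr => l _; rewrite mxE rmorphXn.
Qed.

Lemma hilbert_macaulay k S : (hilbert P k.+1 S < 'C(k.+1 + 2, k.+1))%N ->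
  (hilbert P k.+2 S + hilbert P k S <= hilbert P k.+1 S + hilbert P k.+1 S)%N.
Proof.
rewrite -!hilbert_map; apply: hilbert_macaulay_closed => j.
by rewrite map_mx_eq0; case: ptsP => P0 _.
Qed.

(** A Hilbert function below [3 * k.+2] in degree [k.+2] thus satisfies the hypothesis of Macaulay's
    bound. *)
Lemma ltn_bin_threefold k : (3 * k.+2 - 1 < 'C(k.+2 + 2, k.+2))%N.
Proof.
rewrite -[X in 'C(_, X)](addnK 2 k.+2) bin_sub ?leq_addl // bin2 geq_half_double.
nia.
Qed.

(* By Macaulay's bound, a first difference at most 2 cannot be followed by one
   at least 3. *)
Lemma hilbert_ge_threefold S N : ~ lie_on_curve 1 P S -> (3 * N - 1 <= #|S|)%N ->
  (forall k y, (0 < k <= N)%N -> relation P k y -> supp y \subset S ->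
     (#|supp y| < 3 * k)%N -> y = 0) ->
  forall k, (0 < k < N)%N -> (3 * k <= hilbert P k S)%N.
Proof.
move=> nl cS indep.
have ge k : (0 < k <= N)%N -> (3 * k - 1 <= hilbert P k S)%N.
  move=> kN; apply: hilbert_ge => [|y ry yS cy]; first by lia.
  by apply: (indep k) => //; lia.
elim=> [//|[|k] IHk] kN.
  by rewrite leqNgt; apply/lie_on_curveP.
rewrite leqNgt; apply/negP => hk.
have : (hilbert P k.+2 S < 'C(k.+2 + 2, k.+2))%N.
  by apply: leq_trans (ltn_bin_threefold k); lia.
(* The outer values are at least [3 * k.+3 - 1] and [3 * k.+1], the middle one at most
   [3 * k.+2 - 1]: concavity fails by one. *)
move/hilbert_macaulay; have := IHk _; have := ge k.+3 _; lia.
Qed.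

(** On a conic there are at most 6 support points, few enough to be collinear; then there are at
    most 3, too few for a nonzero relation. *)
Lemma relation_general_eq0 k y S : (0 < k)%N ->
    (forall T, T \subset S -> lie_on_curve 1 P T -> (#|T| <= 3)%N) ->
    (forall T, T \subset S -> lie_on_curve 2 P T -> (#|T| <= 6)%N) ->
  relation P k y -> supp y \subset S -> (#|supp y| < 3 * k)%N ->
  lie_on_curve 2 P (supp y) -> y = 0.
Proof.
move=> k0 lines conics ry yS cy oy; have c6 := conics _ yS oy.
have ly : lie_on_curve 1 P (supp y) by apply: (relation_collinear ptsP ry); lia.
by have c3 := lines _ yS ly; apply: (relation_eq0 ptsP ry); lia.
Qed.

Lemma curve_card_dec k c S : (exists T, [/\ T \subset S, lie_on_curve k P T & (c < #|T|)%N]) \/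
  (forall T, T \subset S -> lie_on_curve k P T -> (#|T| <= c)%N).
Proof.
have [/existsP[T /and3P[h1 /lie_on_curveP h2 h3]]|/existsPn h] :=
  boolP [exists T : {set 'I_n}, [&& T \subset S, (hilbert P k T < 'C(k + 2, k))%N & (c < #|T|)%N]].
  by left; exists T.
right=> T TS /lie_on_curveP oT; rewrite leqNgt; apply/negP => cT.
by have := h T; rewrite TS oT cT.
Qed.

Lemma lie_on_curve_dec k S : lie_on_curve k P S \/ ~ lie_on_curve k P S.
Proof. by case: (lie_on_curveP P k S); [left | right]. Qed.

Lemma residual_card m k y T : relation P m y -> (k <= m)%N -> T \subset supp y ->
    lie_on_curve k P T ->
  exists z, [/\ relation P (m - k) z, supp z \subset supp y,
    (#|supp z| + #|T| <= #|supp y|)%N & lie_on_curve k P (supp y :\: supp z)].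
Proof.
move=> ry km sT oT; have [z [rz sz oz]] := residual ry km sT oT.
exists z; split=> //; first exact: subset_trans sz (subsetDl _ _).
have := subset_leq_card sz; rewrite cardsDS //.
by have := subset_leq_card sT; lia.
Qed.

Lemma relation_conic m y : relation P m y -> (#|supp y| < 3 * m)%N ->
  lie_on_curve 2 P (supp y).
Proof.
elim/ltn_ind: m y => m IHm y ry cy.
have [m2|m3] := leqP m 2.
  by apply: lie_on_curve_small; rewrite (_ : 'C(_, _) = 6) //; lia.
have [[T [sT oT cT]]|lines] := curve_card_dec 1 2 (supp y).
  (* Either the residual [z] is collinear and two lines form the conic, or it has at least [2 * m]
     points and its own conic leaves nothing. *)
  have [|z [rz sz cz oz]] := residual_card ry _ sT oT; first by lia.
  have oz2 : lie_on_curve 2 P (supp z) by apply: IHm rz _; lia.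
  have [c1|c1] := leqP #|supp z| (2 * (m - 1) + 1).
    exact: residual_on oz (relation_collinear ptsP rz c1).
  have [|w [rw sw cw ow]] := residual_card ry _ sz oz2; first by lia.
  by apply: residual_all ow; apply: (relation_eq0 ptsP rw); lia.
have [[T [sT oT cT]]|conics] := curve_card_dec 2 5 (supp y).
  have [|z [rz sz cz oz]] := residual_card ry _ sT oT; first by lia.
  have oz2 : lie_on_curve 2 P (supp z) by apply: IHm rz _; lia.
  have [z0|z0] := eqVneq z 0; first exact: residual_all oz.
  have cz1 := relation_card ptsP rz z0.
  have [c1|c1] := leqP #|supp z| (2 * (m - 2) + 1).
    by have := lines _ sz (relation_collinear ptsP rz c1); lia.
  have [|w [rw sw cw ow]] := residual_card ry _ sz oz2; first by lia.
  have [w0|w0] := eqVneq w 0; first exact: residual_all ow.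
  have cw1 := relation_card ptsP rw w0.
  (* A nonzero [w] would put at least 3 support points on a line. *)
  have lw : lie_on_curve 1 P (supp w) by apply: (relation_collinear ptsP rw); lia.
  by have := lines _ sw lw; lia.
have [//|ny] := lie_on_curve_dec 2 (supp y); exfalso.
have nl : ~ lie_on_curve 1 P (supp y).
  move=> ly; have c2 := lines _ (subxx _) ly; apply: ny.
  by apply: lie_on_curve_small; rewrite (_ : 'C(_, _) = 6) //; lia.
have h1 : (3 <= hilbert P 1 (supp y))%N by rewrite leqNgt; apply/lie_on_curveP.
have h2 : (6 <= hilbert P 2 (supp y))%N by rewrite leqNgt; apply/lie_on_curveP.
have indep k z : (0 < k <= m - 1)%N -> relation P k z -> supp z \subset supp y ->
     (#|supp z| < 3 * k)%N -> z = 0.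
  move=> km rz sz cz; apply: (relation_general_eq0 _ _ _ rz sz cz); first by lia.
  - by move=> T sT lT; have := lines _ sT lT; lia.
  - by move=> T sT lT; have := conics _ sT lT; lia.
  by apply: IHm rz cz; lia.
(* With fewer points, all evaluations would be independent in degree [m - 1], which duality with
   degree 1 forbids. *)
have cS : (3 * (m - 1) - 1 <= #|supp y|)%N.
  rewrite leqNgt; apply/negP => cS.
  have : (#|supp y| <= hilbert P (m - 1) (supp y))%N.
    apply: hilbert_ge => // z rz sz cz.
    by apply: (indep (m - 1)%N) => //; lia.
  have := hilbert_duality ry (ltnW (ltnW m3)); lia.
(* The values 6 in degree 2 and [3 * (m - 2)] in degree [m - 2] add up to [3 * m], more than the
   weight. *)
have hm2 := hilbert_ge_threefold nl cS indep (k := m - 2).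
have d2 := hilbert_duality ry (ltnW m3); lia.
Qed.

Lemma relation_cubic m y : relation P m y -> (#|supp y| <= 3 * m)%N ->
  lie_on_curve 3 P (supp y).
Proof.
move=> ry cy.
have [m3|m4] := leqP m 3.
  by apply: lie_on_curve_small; rewrite (_ : 'C(_, _) = 10) //; lia.
have [[T [sT oT cT]]|lines] := curve_card_dec 1 3 (supp y).
  have [|z [rz sz cz oz]] := residual_card ry _ sT oT; first by lia.
  by apply: (residual_on oz); apply: relation_conic rz _; lia.
have [[T [sT oT cT]]|conics] := curve_card_dec 2 6 (supp y).
  have [|z [rz sz cz oz]] := residual_card ry _ sT oT; first by lia.
  have oz2 : lie_on_curve 2 P (supp z) by apply: relation_conic rz _; lia.
  have [c1|c1] := leqP #|supp z| (2 * (m - 2) + 1).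
    exact: residual_on oz (relation_collinear ptsP rz c1).
  have [|w [rw sw cw ow]] := residual_card ry _ sz oz2; first by lia.
  by apply: (residual_on ow); apply: (relation_collinear ptsP rw); lia.
have [//|ny] := lie_on_curve_dec 3 (supp y); exfalso.
have h3 : (10 <= hilbert P 3 (supp y))%N by rewrite leqNgt; apply/lie_on_curveP.
have nl : ~ lie_on_curve 1 P (supp y).
  by move=> ly; have := lines _ (subxx _) ly; have := hilbert_le_card P 3 (supp y); lia.
have indep k z : (0 < k <= m)%N -> relation P k z -> supp z \subset supp y ->
     (#|supp z| < 3 * k)%N -> z = 0.
  move=> km rz sz cz; apply: (relation_general_eq0 _ _ _ rz sz cz) => //; first by lia.
  exact: relation_conic rz cz.
have cS : (3 * m - 1 <= #|supp y|)%N.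
  rewrite leqNgt; apply/negP => cS; case: ny.
  have oy : lie_on_curve 2 P (supp y) by apply: relation_conic ry _; lia.
  (* A line through no prescribed point completes the conic to a cubic. *)
  have o0 : lie_on_curve 1 P set0 by apply: lie_on_curve_small; rewrite cards0.
  exact: lie_on_curveS (subsetUr _ _) (lie_on_curveU o0 oy).
(* Now 10 in degree 3 and [3 * (m - 3)] in degree [m - 3] add up to [3 * m + 1]. *)
have hm3 := hilbert_ge_threefold nl cS indep (k := m - 3).
have d3 := hilbert_duality ry (ltnW m4); lia.
Qed.
End PlanePoints.

(** * From words of the dual code to relations *)

Section DualCode.
Variables (F : fieldType) (K : closedFieldType) (iota : {rmorphism F -> K}).
Variables (E l : {mpoly F[3]}) (m n : nat) (P : 'I_n -> 'rV[F]_3).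
Hypotheses (l1 : l \is 1.-homog) (P_on_X : forall i, ev E (P i) = 0).
Hypothesis P_off_G : forall i, avoids_support l m (P i).

(** The function [f / l ^+ m] is in the Riemann-Roch space: times the local equation it becomes
    [f / h ^+ m], regular where [h] is nonzero. *)
Lemma code_L_form f : (0 < n)%N -> f \is m.-homog ->
  code_L iota E l m P (\row_i (ev f (P i) / ev (l ^+ m) (P i))).
Proof.
move=> n0 fm; have lm : l ^+ m \is m.-homog by rewrite -{2}[m]mul1n dhomogMn.
have rf : is_ratfun E (f, l ^+ m).
  split; first by exists m.
  (* A point of the curve off the support of the divisor shows that [l ^+ m] is not zero on the
     curve. *)
  move=> [Q /= lQ]; have /negP := P_off_G (Ordinal n0); apply.
  by rewrite lQ evM P_on_X mulr0.
exists (f, l ^+ m); last first.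
  move=> i; exists (f, l ^+ m); split; [exact: rf | | exact: P_off_G | by rewrite mxE].
  by exists 0; rewrite subrr mul0r.
split=> // x h [x0 Ex] h1 hx; exists (f, h ^+ m).
have hm : h ^+ m \is m.-homog by rewrite -{2}[m]mul1n dhomogMn.
have hmx : evK iota (h ^+ m) x != 0 by rewrite /evK rmorphXn evXn expf_neq0.
split=> //.
  split; first by exists m.
  by move=> [Q /= hQ]; move: hmx; rewrite hQ {1}/evK rmorphM evM -!/(evK _ _ _) Ex mulr0 eqxx.
by exists 0; rewrite /= mul0r; ring.
Qed.

(** Dividing the coordinates by the nonzero values of [l ^+ m] preserves the support. *)
Lemma dual_code_relation y : y != 0 -> dual_code (code_L iota E l m P) y ->
  exists z, [/\ relation P m z, z != 0 & #|supp z| = hamming_weight y].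
Proof.
move=> y0 dy; have /rV0Pn[j _] := y0.
have n0 : (0 < n)%N by apply: leq_ltn_trans (ltn_ord j).
pose z := \row_i (y 0 i / ev (l ^+ m) (P i)).
have sz : supp z = [set i | y ord0 i != 0].
  by apply/setP => i; rewrite !inE mxE mulf_eq0 invr_eq0 (negbTE (P_off_G i)) orbF.
exists z; split; last by rewrite sz.
  move=> f fm; rewrite -[RHS](dy _ (code_L_form n0 fm)).
  by apply: eq_bigr => i _; rewrite !mxE; ring.
by rewrite -supp_eq0 sz (supp_eq0 y).
Qed.
End DualCode.

(** * Weight bounds from the position of the points *)

Section Weights.
Variables (F : fieldType) (K : closedFieldType) (iota : {rmorphism F -> K}).
Variables (m n : nat) (P : 'I_n -> 'rV[F]_3) (z : 'rV[F]_n).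
Hypotheses (ptsP : projective_points P) (rz : relation P m z) (z0 : z != 0).
Hypothesis nline : no_lie_on_curve (m + 2) 1 P.

Lemma no_lie_card r k (S : {set 'I_n}) :
  no_lie_on_curve r k P -> lie_on_curve k P S -> (#|S| < r)%N.
Proof.
move=> no oS; rewrite ltnNge; apply/negP => /subset_of_card[T [sT cT]].
exact: (no T cT (lie_on_curveS sT oS)).
Qed.

Lemma relation_weight_lines : (2 * m + 2 <= #|supp z|)%N.
Proof.
rewrite leqNgt; apply/negP => cz.
have lz : lie_on_curve 1 P (supp z) by apply: (relation_collinear ptsP rz); lia.
by have := no_lie_card nline lz; have := relation_card ptsP rz z0; lia.
Qed.

Hypothesis nconic : no_lie_on_curve (2 * m + 2) 2 P.

(** A smaller support would lie on a conic, yet it has at least [2 * m + 2] points by the bound for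
    lines. *)
Lemma relation_weight_conics : (3 * m <= #|supp z|)%N.
Proof.
rewrite leqNgt; apply/negP => cz.
have := no_lie_card nconic (relation_conic iota ptsP rz cz).
by have := relation_weight_lines; lia.
Qed.

Lemma relation_weight_cubics :
  no_lie_on_curve (3 * m) 3 P -> (3 * m + 1 <= #|supp z|)%N.
Proof.
move=> ncubic; rewrite leqNgt; apply/negP => cz.
have cz' : (#|supp z| <= 3 * m)%N by lia.
have := no_lie_card ncubic (relation_cubic iota ptsP rz cz').
by have := relation_weight_conics; lia.
Qed.
End Weights.

Theorem theorem4p4
  (F : finFieldType) (K : closedFieldType) (iota : {rmorphism F -> K})
  (algebraicK : integralRange iota)
  (a : nat) (ha : (3 <= a)%N)
  (E : {mpoly F[3]}) (degE : is_curve a E) (smoothE : smooth_curve iota E)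
  (m : nat)
  (l : {mpoly F[3]}) (line_l : is_curve 1 l)
  (n : nat) (P : 'I_n -> 'rV[F]_3) (ptsP : projective_points P)
  (P_on_X : forall i, ev E (P i) = 0)
  (P_off_G : forall i, avoids_support l m (P i)) :
  [/\ (m <= a - 2)%N ->
      no_lie_on_curve (m + 2) 1 P ->
      (forall d, is_min_distance (dual_code (code_L iota E l m P)) d ->
         (2 * m + 2 <= d)%N) /\
      goppa_distance a m < (2 * m + 2)%N%:Z,

      (m <= a - 1)%N ->
      no_lie_on_curve (m + 2) 1 P ->
      no_lie_on_curve (2 * m + 2) 2 P ->
      (forall d, is_min_distance (dual_code (code_L iota E l m P)) d ->
         (3 * m <= d)%N) /\
      (goppa_distance a m <= (3 * m)%N%:Z /\
       ((3 < a)%N -> goppa_distance a m < (3 * m)%N%:Z))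
    & (m <= a)%N ->
      no_lie_on_curve (m + 2) 1 P ->
      no_lie_on_curve (2 * m + 2) 2 P ->
      no_lie_on_curve (3 * m) 3 P ->
      (forall d, is_min_distance (dual_code (code_L iota E l m P)) d ->
         (3 * m + 1 <= d)%N) /\
      goppa_distance a m < (3 * m + 1)%N%:Z].
Proof.
have weight d N : (forall z, relation P m z -> z != 0 -> (N <= #|supp z|)%N) ->
    is_min_distance (dual_code (code_L iota E l m P)) d -> (N <= d)%N.
  move=> hN [[c [dc c0 <-]] _]; have [_ l1] := line_l.
  by have [z [rz z0 <-]] := dual_code_relation l1 P_on_X P_off_G c0 dc; apply: hN.
rewrite goppa_distanceE; last by lia.
split.
(* The gain over Goppa's bound is [(a - 2) * (a - 1 - m)]. *)
- move=> ma nl; split=> [d|]; last by nia.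
  by apply: weight => z rz z0; apply: (relation_weight_lines ptsP rz z0 nl).
(* The gain is [(a - 3) * (a - m)], which is zero for [a = 3]. *)
- move=> ma nl nc; split=> [d|]; last by split; nia.
  by apply: weight => z rz z0; apply: (relation_weight_conics iota ptsP rz z0).
(* The gain is [(a - 3) * (a - m) + 1]. *)
move=> ma nl nc ncub; split=> [d|]; last by nia.
by apply: weight => z rz z0; apply: (relation_weight_cubics iota ptsP rz z0).
Qed.
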